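(* Let $n,m\ge 1$, let $X$ be a non-empty finite set, let $V^1,\dots,V^{n+m}:\Delta(X)\to\mathbb{R}$ be continuous functions, and let $f:\mathbb{R}^{n+m}\to\mathbb{R}$ be a continuous function that is constant in its last $m$ arguments. Let $\mu\in\Delta(X)$ and suppose there is some $P\in\Delta^2(X)$ with $E_P[\nu]=\mu$ and $E_P[V^i]\ge 0$ for all $i>n$. Then there exist $P^*\in\Delta^2(X)$ solving $$\sup_{P\in\Delta^2(X)} f\left(E_P[V^1],\dots,E_P[V^{n+m}]\right)\quad\text{s.t.}\quad E_P[V^i]\ge 0\ \text{ for all } n<i\le n+m,\ \ E_P[\nu]=\mu,$$ and a nonzero vector $\lambda=(\lambda^1,\dots,\lambda^{n+m})$ in the closed unit ball of $\mathbb{R}^{n+m}$ such that $$P^*\in\arg\max_{\substack{P\in\Delta^2(X)\\ E_P[\nu]=\mu}} E_P\left[\sum_{i=1}^{n+m}\lambda^iV^i\right].$$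
   Context: $\Delta(X)\subset\mathbb{R}^{|X|}$ is the simplex of probability measures on the finite set $X$, and $\Delta^2(X)$ is the set of all Borel probability measures on $\Delta(X)$. For $P\in\Delta^2(X)$, $E_P[\nu]=\int_{\Delta(X)}\nu\,dP(\nu)$ is the barycenter and $E_P[V]=\int_{\Delta(X)}V(\nu)\,dP(\nu)$. ''$P^*$ solves'' a maximization problem means $P^*$ is feasible and attains the supremum. *)

(* Defs.v *)
(* MathComp-Analysis; the real numbers are an arbitrary [R : realType]. *)
From HB Require Import structures.
From mathcomp Require Import all_boot all_order all_algebra.
From mathcomp Require Import all_classical all_reals all_analysis.
Set Implicit Arguments.
Unset Strict Implicit.
Unset Printing Implicit Defensive.
Import Order.TTheory GRing.Theory Num.Theory.
Import numFieldNormedType.Exports.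
Local Open Scope classical_set_scope.
Local Open Scope ring_scope.

(* R^|X| is the space of functions X -> R with the product topology; as X is
   finite this is the usual Euclidean topology. *)
Definition simplex (R : realType) (X : finType) : set {ptws X -> R} :=
  [set p | (forall x, 0 <= p x) /\ \sum_(x : X) p x = 1].
Arguments simplex : clear implicits.

(* The proof that X is non-empty is an argument because the library's
   measurable types are inhabited. *)
Definition Delta (R : realType) (X : finType) (hX : (0 < #|X|)%N) : Type :=
  set_type (simplex R X).
Arguments Delta R {X} hX.

Section delta_structure.
Variables (R : realType) (X : finType) (hX : (0 < #|X|)%N).

(* Subspace topology and metric inherited from R^|X|. *)
HB.instance Definition _ :=
  PseudoMetric.copy (Delta R hX) (set_type (simplex R X)).

Let x0 : X := enum_val (Ordinal hX).

Lemma simplex_vertex : (fun x => (x == x0)%:R) \in simplex R X.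
Proof.
apply/mem_set; split => [x|]; first exact: ler0n.
by rewrite (bigD1 x0) //= eqxx big1 ?addr0 // => i /negPf ->.
Qed.

HB.instance Definition _ :=
  isPointed.Build (Delta R hX) (exist (fun p => p \in simplex R X) _ simplex_vertex).

(* Borel sigma-algebra, generated by the open sets. *)
HB.instance Definition _ :=
  Measurable.copy (Delta R hX) (g_sigma_algebraType (@open (Delta R hX))).

End delta_structure.

Definition mass (R : realType) (X : finType) (hX : (0 < #|X|)%N)
  (nu : Delta R hX) : X -> R := val nu.

Definition Delta2 (R : realType) (X : finType) (hX : (0 < #|X|)%N) : Type :=
  probability (Delta R hX) R.
Arguments Delta2 R {X} hX.

(* Rintegral is junk on non-integrable functions, but continuous functions on
   the compact space Delta are bounded and Borel, hence integrable. *)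
Definition expect (R : realType) (X : finType) (hX : (0 < #|X|)%N)
  (P : Delta2 R hX) (W : Delta R hX -> R) : R := \int[P]_nu W nu.

Definition barycenter (R : realType) (X : finType) (hX : (0 < #|X|)%N)
  (P : Delta2 R hX) : X -> R := fun x => expect P (fun nu => mass nu x).

Definition solves_sup (R : realType) (T : Type) (J : T -> R) (S : set T)
  (p : T) : Prop :=
  S p /\ (J p)%:E = ereal_sup [set (J q)%:E | q in S].

Definition argmax (R : realType) (T : Type) (J : T -> R) (S : set T) : set T :=
  [set p | S p /\ forall q, S q -> J q <= J p].

(* The library's norm on row vectors is the sup norm. *)
Definition eucl_norm (R : realType) (k : nat) (v : 'rV[R]_k) : R :=
  Num.sqrt (\sum_(i < k) v ord0 i ^+ 2).

(* Main.v *)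
Require Import Defs.
From HB Require Import structures.
From mathcomp Require Import all_boot all_order all_algebra.
From mathcomp Require Import all_classical all_reals all_analysis.
From mathcomp Require Import measurable_realfun ring lra zify.
Set Implicit Arguments.
Unset Strict Implicit.
Import Order.TTheory GRing.Theory Num.Theory.
Import numFieldNormedType.Exports.
Local Open Scope classical_set_scope.
Local Open Scope ring_scope.

(** Everything about a measure P that the problem sees is its vector of moments
    (E_P[V^i])_i. Let K be the set of these vectors over all P with barycenter
    mu. The objective and the constraints are a function of, and a condition on,
    a point of K, and maximizing E_P[sum_i lambda^i V^i] is maximizing a linear
    functional over K. So the theorem follows from two facts.

    K is compact and convex. Put G(nu) = (nu, V(nu)), a continuous map on the
    compact simplex. The moments of G under a probability measure P lie in the
    convex hull of the range of G, as otherwise a linear functional would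
    separate them from the hull, and the P-mean of this functional composed with
    G would exceed its maximum (moments_in_hull). Conversely a point of the hull is the moment vector of a
    finitely supported P (expect_weighted_atoms). By Caratheodory a fixed number
    of points suffices to describe the hull, so it is a continuous image of a
    compact set (convex_combs_compact, caratheodory). K is the slice of this hull
    on which the first block of coordinates equals mu (attainableP).

    Among the feasible maximizers of f over K there is one on the boundary of K
    (constrained_max_supported). Take, among the maximizers, a point v whose
    first constrained coordinate is largest. Increasing that coordinate leaves f
    unchanged and keeps the constraints, so v + eps e must leave K for every
    eps > 0. Strictly separating these outside points from K by unit functionals
    and letting eps go to 0 gives, by compactness of the unit sphere, a unit
    functional lambda that is maximized over K at v (supporting_functional). *)

(** * Continuity and the Euclidean inner product *)

Lemma continuous_sumr (R : numFieldType) (T : topologicalType)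
  (W : normedModType R) (I : Type) (s : seq I) (g : I -> T -> W) :
  (forall i, continuous (g i)) -> continuous (fun x => \sum_(i <- s) g i x).
Proof.
move=> cg; elim: s => [|i s IH].
  under eq_fun do rewrite big_nil.
  exact: cst_continuous.
under eq_fun do rewrite big_cons.
move=> x; apply: cvgD; [exact: cg | exact: IH].
Qed.

Lemma continuous_row (R : realType) (T : topologicalType) d
  (g : T -> 'rV[R]_d) :
  (forall i, continuous (fun x => g x ord0 i)) -> continuous g.
Proof.
move=> cg x; apply/cvg_ballP => e e0.
have : \forall y \near x, forall i, ball (g x ord0 i) e (g y ord0 i).
  apply: filter_forall => i.
  by have /cvg_ballP := cg i x; exact.
apply: filterS => y H.
by split => // i j; rewrite ord1.
Qed.

Section inner_product.
Variables (R : realType) (d : nat).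
Implicit Types u v w : 'rV[R]_d.

Definition dotv u v : R := \sum_i u ord0 i * v ord0 i.

Lemma dotvC u v : dotv u v = dotv v u.
Proof. by apply: eq_bigr => i _; rewrite mulrC. Qed.

Lemma dotvD u v w : dotv u (v + w) = dotv u v + dotv u w.
Proof.
by rewrite -big_split; apply: eq_bigr => i _ /=; rewrite mxE mulrDr.
Qed.

Lemma dotv0 u : dotv u 0 = 0.
Proof. by rewrite /dotv big1 // => i _; rewrite mxE mulr0. Qed.

Lemma dotvZ a u v : dotv u (a *: v) = a * dotv u v.
Proof. by rewrite mulr_sumr; apply: eq_bigr => i _ /=; rewrite mxE mulrCA. Qed.

Lemma dotvN u v : dotv u (- v) = - dotv u v.
Proof. by rewrite -scaleN1r dotvZ mulN1r. Qed.

Lemma dotvB u v w : dotv u (v - w) = dotv u v - dotv u w.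
Proof. by rewrite dotvD dotvN. Qed.

Lemma dotvv_ge0 u : 0 <= dotv u u.
Proof. by apply: sumr_ge0 => i _; rewrite -expr2 sqr_ge0. Qed.

Lemma dotvv_eq0 u : (dotv u u == 0) = (u == 0).
Proof.
apply/eqP/eqP => [u0|->]; last by rewrite /dotv big1 // => i _; rewrite mxE mul0r.
apply/rowP => i; rewrite mxE; apply/eqP; rewrite -sqrf_eq0 expr2; apply/eqP.
by apply: (psumr_eq0P _ u0) => // j _; rewrite -expr2 sqr_ge0.
Qed.

Lemma dotvv_gt0 u : (0 < dotv u u) = (u != 0).
Proof. by rewrite lt_def dotvv_eq0 dotvv_ge0 andbT. Qed.

Lemma dotvv_ZB t u v : dotv (t *: u - v) (t *: u - v) =
  t * t * dotv u u - 2 * t * dotv v u + dotv v v.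
Proof.
rewrite dotvB dotvZ ![dotv (_ - _) _]dotvC !dotvB !dotvZ (dotvC u v).
by ring.
Qed.

Lemma dotv_continuous (T : topologicalType) (g h : T -> 'rV[R]_d) :
  continuous g -> continuous h -> continuous (fun z => dotv (g z) (h z)).
Proof.
move=> cg ch.
apply: (@continuous_sumr _ T R^o _ _ (fun i z => g z ord0 i * h z ord0 i)) => i x.
have coord (k : T -> 'rV[R]_d) : continuous k -> continuous (fun x => k x ord0 i).
  move=> ck y; apply: (@continuous_comp _ _ _ k (fun M : 'rV[R]_d => M ord0 i)).
    exact: ck.
  exact: coord_continuous.
by apply: cvgM; exact: coord.
Qed.

End inner_product.


(** * Compact sets *)

Section compactness.
Variable R : realType.

Lemma unit_sphere_compact d : compact [set l : 'rV[R]_d | dotv l l = 1].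
Proof.
apply: (@subclosed_compact _ _ [set v : 'rV[R]_d | forall i, v ord0 i \in `[-1, 1]]).
- have cdot : continuous (fun l : 'rV[R]_d => dotv l l).
    by apply: dotv_continuous => ? ?.
  by move/continuous_closedP : cdot => /(_ [set 1]); apply; exact: closed_eq.
- apply: (@rV_compact R d (fun=> `[-1, 1]%classic)) => _.
  exact: segment_compact.
- move=> l /= l1 i; rewrite in_itv /= -ler_norml.
  rewrite -(ler_pXn2r (ltn0Sn 1)) ?nnegrE // expr1n real_normK ?num_real //.
  rewrite -l1 /dotv (bigD1 i) //= -expr2 lerDl.
  by apply: sumr_ge0 => j _; rewrite -expr2 sqr_ge0.
Qed.

Lemma simplex_compact (X : finType) : compact (simplex R X).
Proof.
have cpt : compact [set p : {ptws X -> R} | forall x, `[0, 1]%classic (p x)].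
  apply: (@tychonoff X (fun=> R) (fun=> `[0, 1]%classic)) => _; exact: segment_compact.
apply: subclosed_compact cpt _.
  have ccoord x : continuous (fun p : {ptws X -> R} => p x).
    exact: (@proj_continuous X (fun=> R) x).
  have -> : simplex R X = (\bigcap_(x in setT) [set p : {ptws X -> R} | 0 <= p x])
      `&` [set p : {ptws X -> R} | \sum_x p x = 1].
    apply/seteqP; split=> p [p0 p1]; split=> // x.
      by move=> _; exact: p0.
    exact: p0 x I.
  apply: closedI.
    apply: closed_bigI => x _.
    move/continuous_closedP : (ccoord x) => /(_ [set y | 0 <= y]); apply.
    exact: closed_ge.
  have csum : continuous (fun p : {ptws X -> R} => \sum_x p x).
    exact: (@continuous_sumr R {ptws X -> R} R^o).
  by move/continuous_closedP : csum => /(_ [set 1]); apply; exact: closed_eq.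
move=> p [p0 p1] x /=; rewrite in_itv /= p0 /= -p1 (bigD1 x) //= lerDl.
exact: sumr_ge0.
Qed.

End compactness.

(** * Separating and supporting functionals *)

Section separation.
Variables (R : realType) (d : nat).
Implicit Types (u v x y : 'rV[R]_d) (C : set 'rV[R]_d).

Lemma convex_setP C : @convex_set R 'rV[R]_d C <->
  forall x y (t : R), C x -> C y -> 0 <= t <= 1 -> C (t *: x + (1 - t) *: y).
Proof.
split=> [cC x y t Cx Cy /andP[t0 t1]|cC x y t /set_mem Cx /set_mem Cy].
  by have /set_mem := cC x y (Itv01 t0 t1) (mem_set Cx) (mem_set Cy).
apply/mem_set; apply: cC => //.
by apply/andP; split; [exact: ge0 | exact: le1].
Qed.

(** The functional is x - c, where c is the point of C nearest to x: moving from
    c towards another point y of C cannot decrease the distance to x to first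
    order, which says that y - c has no positive component along x - c. *)
Lemma strict_separation C x : compact C -> @convex_set R 'rV[R]_d C ->
  C !=set0 -> ~ C x ->
  exists2 l, l != 0 & forall y, C y -> dotv l y < dotv l x.
Proof.
move=> cptC /convex_setP cvxC C0 Cx.
have [|c /set_mem Cc cmin] := @compact_EVT_min _ R
    (fun y => dotv (y - x) (y - x)) C C0 cptC.
  have cB : continuous (fun y : 'rV[R]_d => y - x).
    by move=> y; apply: (@continuousB R _ _ id (cst x)) => //; exact: cst_continuous.
  by apply: continuous_subspaceT; exact: dotv_continuous.
have xc : x - c != 0 by rewrite subr_eq0; apply: contra_notN Cx => /eqP ->.
exists (x - c) => // y Cy.
suff H : dotv (x - c) (y - c) <= 0.
  have : 0 < dotv (x - c) (x - c) by rewrite dotvv_gt0.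
  move: H; rewrite [dotv _ (y - c)]dotvB [dotv _ (x - c)]dotvB; lra.
rewrite leNgt; apply/negP; set a := dotv (x - c) (y - c) => a0.
set b := dotv (y - c) (y - c).
have b0 : 0 <= b by exact: dotvv_ge0.
(* The squared distance from x to t y + (1 - t) c is t^2 b - 2 t a plus the
   minimum; this t makes t b <= a, so the point is too close to x. *)
pose t := a / (b + a).
have ba0 : 0 < b + a by rewrite ltr_wpDl.
have t0 : 0 < t by rewrite divr_gt0.
have t1 : t <= 1 by rewrite ler_pdivrMr // mul1r lerDr.
have tba : t * (b + a) = a by rewrite divfK // gt_eqF.
have Cz : C (t *: y + (1 - t) *: c) by apply: cvxC => //; rewrite (ltW t0).
have := cmin _ (mem_set Cz).
have -> : t *: y + (1 - t) *: c - x = t *: (y - c) - (x - c).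
  by apply/rowP => i; rewrite !mxE; ring.
have -> : dotv (c - x) (c - x) = dotv (x - c) (x - c).
  by rewrite -opprB dotvN dotvC dotvN opprK.
rewrite dotvv_ZB -/a -/b.
have : t * t * b <= t * a by rewrite -mulrA ler_pM2l //; nra.
nra.
Qed.

End separation.

(** The hypothesis on e places x on the boundary of C, also when C lies in a
    proper subspace. The functional is a cluster point of unit functionals that
    separate C from points of the ray tending to x. *)
Lemma supporting_functional (R : realType) d (C : set 'rV[R]_d) (x e : 'rV[R]_d) :
  compact C -> @convex_set R 'rV[R]_d C -> C x ->
  (forall eps, 0 < eps -> ~ C (x + eps *: e)) ->
  exists2 l, dotv l l = 1 & forall y, C y -> dotv l y <= dotv l x.
Proof.
move=> cptC cvxC Cx Ce.
pose eps (k : nat) : R := k.+1%:R^-1.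
have eps0 k : 0 < eps k by rewrite invr_gt0 ltr0n.
have /choice[l lP] k : exists l : 'rV[R]_d, dotv l l = 1 /\
    forall y, C y -> dotv l (y - x) < eps k * dotv l e.
  have [|l l0 lP] := strict_separation cptC cvxC _ (Ce _ (eps0 k)).
    by exists x.
  set q := dotv l l; have q0 : 0 < q by rewrite dotvv_gt0.
  have rq0 : 0 < (Num.sqrt q)^-1 by rewrite invr_gt0 sqrtr_gt0.
  exists ((Num.sqrt q)^-1 *: l); split.
    rewrite dotvZ dotvC dotvZ mulrA -/q -[X in _ * X](sqr_sqrtr (ltW q0)).
    by field; rewrite gt_eqF // sqrtr_gt0.
  move=> y Cy; rewrite ![dotv (_ *: l) _]dotvC !dotvZ mulrCA ltr_pM2l //.
  rewrite dotvC [dotv e l]dotvC dotvB ltrBlDl -dotvZ -dotvD.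
  exact: lP.
have [p [p1 clp]] : [set l : 'rV[R]_d | dotv l l = 1] `&` cluster (l @ \oo) !=set0.
  by apply: unit_sphere_compact; exists 0%N => // k _; exact: (lP k).1.
exists p => // y Cy.
(* For fixed k this inequality holds for l j with j >= k, because
   dotv (l j) e > 0, and it is closed in l; hence it passes to p. *)
have Hp k : dotv p (y - x) <= eps k * dotv p e.
  have cB : continuous (fun l : 'rV[R]_d => dotv l (y - x - eps k *: e)).
    by apply: dotv_continuous => [? ?|?]; [|exact: cst_continuous].
  rewrite -dotvZ -subr_le0 -dotvB.
  move/continuous_closedP : cB => /(_ [set z | z <= 0] (@closed_le _ 0)).
  apply; move: clp; rewrite clusterE; apply.
  exists k => // j /= kj.
  rewrite dotvB subr_le0 dotvZ.
  apply: le_trans (ltW ((lP j).2 _ Cy)) _.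
  have le0 : 0 < dotv (l j) e.
    have := (lP j).2 _ Cx.
    by rewrite subrr dotv0 pmulr_rgt0.
  by rewrite ler_pM2r // lef_pV2 ?posrE // ler_nat.
have : dotv p (y - x) <= 0; last by rewrite dotvB subr_le0.
rewrite leNgt; apply/negP; set a := dotv _ _ in Hp * => a0.
set b := dotv p e in Hp.
have b0 : 0 < b by rewrite -(pmulr_rgt0 _ (eps0 0%N)); exact: lt_le_trans (Hp _).
have [k _ /(_ k (leqnn k)) kab] := near_infty_natSinv_lt (PosNum (divr_gt0 a0 b0)).
by have := Hp k; rewrite leNgt -ltr_pdivlMr // kab.
Qed.

(** * Convex hulls *)

Section convex_combinations.
Variables (R : realType) (d : nat).
Implicit Types (S : set 'rV[R]_d) (N : nat).

Definition convex_combs N S : set 'rV[R]_d :=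
  [set v | exists w s, [/\ simplex R 'I_N w, forall k, S (s k) &
                           v = \sum_k w k *: s k]].

(** With a fixed number of points, the weights and the points range over compact
    product spaces. *)
Lemma convex_combs_compact N S : compact S -> compact (convex_combs N S).
Proof.
move=> cptS.
pose A := simplex R 'I_N `*` [set s : {ptws 'I_N -> 'rV[R]_d} | forall k, S (s k)].
pose phi (z : {ptws 'I_N -> R} * {ptws 'I_N -> 'rV[R]_d}) := \sum_k z.1 k *: z.2 k.
have -> : convex_combs N S = phi @` A.
  apply/seteqP; split=> v.
    by move=> [w [s [ws Ss ->]]]; exists (w, s).
  by move=> [[w s] [/= ws Ss] <-]; exists w, s.
apply: continuous_compact; last first.
  apply: compact_setX; first exact: simplex_compact.
  exact: (@tychonoff 'I_N (fun=> 'rV[R]_d) (fun=> S)).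
apply: continuous_subspaceT.
have cw k : continuous (fun z : {ptws 'I_N -> R} * {ptws 'I_N -> 'rV[R]_d} => z.1 k).
  move=> z; apply: (@continuous_comp _ _ _ fst (fun p : {ptws 'I_N -> R} => p k)).
    exact: cvg_fst.
  exact: (@proj_continuous 'I_N (fun=> R) k).
have cs k : continuous (fun z : {ptws 'I_N -> R} * {ptws 'I_N -> 'rV[R]_d} => z.2 k).
  move=> z.
  apply: (@continuous_comp _ _ _ snd (fun p : {ptws 'I_N -> 'rV[R]_d} => p k)).
    exact: cvg_snd.
  exact: (@proj_continuous 'I_N (fun=> 'rV[R]_d) k).
apply: (@continuous_sumr R ({ptws 'I_N -> R} * {ptws 'I_N -> 'rV[R]_d})%type _ _ _
  (fun k z => z.1 k *: z.2 k)) => k z.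
exact: (@continuousZ R 'rV[R]_d _ _ _ z (cw k z) (cs k z)).
Qed.

(** The points, each extended by a last coordinate 1, are more than d + 1 vectors
    in dimension d + 1. *)
Lemma affine_dependence N (s : 'I_N -> 'rV[R]_d) : (d.+1 < N)%N ->
  exists u : 'I_N -> R,
    [/\ \sum_k u k = 0, \sum_k u k *: s k = 0 & exists k, 0 < u k].
Proof.
move=> dN.
pose M := row_mx (\matrix_(k < N) s k) (const_mx 1 : 'cV[R]_N).
have /rowV0Pn[u /sub_kermxP uM u0] : kermx M != 0.
  rewrite -mxrank_eq0 mxrank_ker -lt0n subn_gt0.
  by apply: leq_ltn_trans (rank_leq_col _) _; rewrite addn1.
move: uM; rewrite mul_mx_row -row_mx0 => /eq_row_mx[uS u1].
have sum_u : \sum_k u 0 k = 0.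
  move/rowP : u1 => /(_ 0); rewrite !mxE => u1; rewrite -[RHS]u1.
  by apply: eq_bigr => k _; rewrite mxE mulr1.
exists (u 0); split => //.
  by rewrite -[RHS]uS mulmx_sum_row; apply: eq_bigr => k _; rewrite rowK.
apply: contrapT => /forallNP u_le0; move/eqP: u0; apply.
have oppu_ge0 k : true -> 0 <= - u 0 k by rewrite oppr_ge0 leNgt; move/negP: (u_le0 k).
apply/rowP => k; rewrite mxE; apply/eqP; rewrite -oppr_eq0; apply/eqP.
by apply: (psumr_eq0P oppu_ge0) => //; rewrite sumrN sum_u oppr0.
Qed.

(** Subtracting from the weights a multiple of an affine dependence does not move
    the point; the largest multiple that keeps them nonnegative kills one. *)
Lemma caratheodory_step N S : (d < N)%N ->
  convex_combs N.+1 S `<=` convex_combs N S.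
Proof.
move=> dN _ [w [s [[w0 w1] Ss ->]]].
have [u [u0 us [k0 uk0]]] := @affine_dependence N.+1 s dN.
case: (@arg_minP _ R 'I_N.+1 k0 (fun k => 0 < u k) (fun k => w k / u k) uk0)
  => i ui imin.
pose t := w i / u i.
pose w' k := w k - t * u k.
have w'_ge0 k : 0 <= w' k.
  rewrite subr_ge0; have [uk|uk] := ltP 0 (u k).
    by rewrite -ler_pdivlMr // imin.
  by apply: le_trans (w0 k); rewrite mulr_ge0_le0 // divr_ge0 // ltW.
have w'i : w' i = 0 by rewrite /w' divfK ?subrr // gt_eqF.
have sumw' (V : lmodType R) (F : 'I_N.+1 -> V) : \sum_k u k *: F k = 0 ->
    \sum_(k < N) w' (lift i k) *: F (lift i k) = \sum_k w k *: F k.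
  move=> uF; have -> : \sum_k w k *: F k = \sum_k w' k *: F k.
    under [RHS]eq_bigr do rewrite scalerBl -scalerA.
    by rewrite sumrB -scaler_sumr uF scaler0 subr0.
  by rewrite (bigD1_ord i) //= w'i scale0r add0r.
exists (fun k => w' (lift i k)), (fun k => s (lift i k)); split => //.
  split=> [k|]; first exact: w'_ge0.
  have := sumw' R^o (fun=> 1); rewrite -!scaler_suml u0 scale0r w1 => /(_ erefl).
  by rewrite /GRing.scale /= !mulr1.
by rewrite sumw'.
Qed.

Lemma caratheodory N S : convex_combs (d.+1 + N) S `<=` convex_combs d.+1 S.
Proof.
elim: N => [|N IH]; first by rewrite addn0.
rewrite addnS; apply: subset_trans IH; apply: caratheodory_step; lia.
Qed.

(** Mixing two combinations doubles the number of points, and the Caratheodory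
    theorem brings it back to d + 1. *)
Lemma convex_combs_convex S : @convex_set R 'rV[R]_d (convex_combs d.+1 S).
Proof.
apply/convex_setP => _ _ t [w [s [[w0 w1] Ss ->]]] [w' [s' [[w'0 w'1] Ss' ->]]].
move=> /andP[t0 t1]; apply: (@caratheodory d.+1).
pose pick T (a b : 'I_d.+1 -> T) (k : 'I_(d.+1 + d.+1)) :=
  match fintype.split k with inl i => a i | inr i => b i end.
have pickl T (a b : 'I_d.+1 -> T) i : pick T a b (lshift _ i) = a i.
  by rewrite /pick (unsplitK (inl i)).
have pickr T (a b : 'I_d.+1 -> T) i : pick T a b (rshift _ i) = b i.
  by rewrite /pick (unsplitK (inr i)).
exists (pick _ (fun k => t * w k) (fun k => (1 - t) * w' k)), (pick _ s s').
split.
- split=> [k|].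
    by rewrite /pick; case: fintype.split => i; rewrite mulr_ge0 // subr_ge0.
  rewrite big_split_ord /=.
  under eq_bigr do rewrite pickl.
  under [X in _ + X]eq_bigr do rewrite pickr.
  by rewrite -!mulr_sumr w1 w'1 !mulr1 addrC subrK.
- by move=> k; rewrite /pick; case: fintype.split.
- rewrite big_split_ord /= !scaler_sumr; congr (_ + _).
    by apply: eq_bigr => k _; rewrite !pickl scalerA.
  by apply: eq_bigr => k _; rewrite !pickr scalerA.
Qed.

Lemma sub_convex_combs N S : S `<=` convex_combs N.+1 S.
Proof.
move=> x Sx; exists (fun k => (k == ord0)%:R), (fun=> x); split => //.
  split=> [k|]; first exact: ler0n.
  by rewrite (bigD1 ord0) //= big1 ?addr0 // => k /negPf ->.
rewrite -scaler_suml (bigD1 ord0) //= big1 ?addr0 ?scale1r //.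
by move=> k /negPf ->.
Qed.

End convex_combinations.

Section slices.
Variables (R : realType) (p q : nat) (H : set 'rV[R]_(p + q)) (c : 'rV[R]_p).

Definition slice : set 'rV[R]_q := [set v | H (row_mx c v)].

Lemma slice_convex : @convex_set R 'rV[R]_(p + q) H -> @convex_set R 'rV[R]_q slice.
Proof.
move=> /convex_setP cvxH; apply/convex_setP => x y t Hx Hy t01.
rewrite /slice /= (_ : row_mx _ _ = t *: row_mx c x + (1 - t) *: row_mx c y).
  exact: cvxH.
by rewrite !scale_row_mx add_row_mx -scalerDl (addrC t) subrK scale1r.
Qed.

(** The slice is the projection of a closed part of H. *)
Lemma slice_compact : compact H -> compact slice.
Proof.
move=> cptH.
have csub r (k : 'I_r -> 'I_(p + q)) :
    continuous (fun z : 'rV[R]_(p + q) => \row_i z ord0 (k i)).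
  apply: continuous_row => i; under eq_fun do rewrite mxE.
  exact: coord_continuous.
have -> : slice = (fun z : 'rV[R]_(p + q) => \row_i z ord0 (rshift p i)) @`
    (H `&` [set z | dotv ((\row_i z ord0 (lshift q i)) - c)
                         ((\row_i z ord0 (lshift q i)) - c) = 0]).
  have lE (z : 'rV[R]_(p + q)) : \row_i z ord0 (lshift q i) = lsubmx z.
    by apply/rowP => i; rewrite !mxE.
  have rE (z : 'rV[R]_(p + q)) : \row_i z ord0 (rshift p i) = rsubmx z.
    by apply/rowP => i; rewrite !mxE.
  apply/seteqP; split=> [v Hv|_ [z [Hz /= zc] <-]].
    exists (row_mx c v); last by rewrite rE row_mxKr.
    by split => //=; rewrite lE row_mxKl subrr dotv0.
  move/eqP : zc; rewrite lE dotvv_eq0 subr_eq0 => /eqP zc.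
  by rewrite /slice /= rE -zc hsubmxK.
apply: continuous_compact; first by apply: continuous_subspaceT; exact: csub.
apply: compact_closedI cptH _.
have cB : continuous (fun z : 'rV[R]_(p + q) => \row_i z ord0 (lshift q i) - c).
  move=> z; apply: (@continuousB R _ _ _ (cst c)); first exact: csub.
  exact: cst_continuous.
have /continuous_closedP/(_ [set 0]) := dotv_continuous cB cB.
by apply; exact: closed_eq.
Qed.

End slices.

(** * Expectations of continuous functions *)

Section expectation.
Variables (R : realType) (X : finType) (hX : (0 < #|X|)%N).
Implicit Types (P : Delta2 R hX) (W : Delta R hX -> R).

Lemma val_continuous : continuous (val : Delta R hX -> {ptws X -> R}).
Proof. exact: initial_continuous. Qed.

Lemma mass_continuous x : continuous (fun nu : Delta R hX => mass nu x).
Proof.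
move=> nu; apply: (@continuous_comp _ _ _ (val : Delta R hX -> {ptws X -> R})
  (fun p : {ptws X -> R} => p x)).
  exact: val_continuous.
exact: (@proj_continuous X (fun=> R) x).
Qed.

(** A cluster point of the image filter in R^X lies in the simplex, and open sets
    of Delta are preimages of open sets of R^X. *)
Lemma Delta_compact : compact [set: Delta R hX].
Proof.
move=> F FF _.
have [p [Sp clp]] : simplex R X `&` cluster ((val : Delta R hX -> {ptws X -> R}) @ F) !=set0.
  apply: (simplex_compact (F := val @ F)).
  by apply: (@filterE _ F) => nu; exact: (set_mem (valP nu)).
pose nu : Delta R hX := SigSub (mem_set Sp).
exists nu; split => // A B FA [C [[D oD DC] Cnu CB]].
pose v : Delta R hX -> {ptws X -> R} := val.
have FvA : F (v @^-1` (v @` A)) by apply: filterS FA => xi Axi; exists xi.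
have Dp : nbhs p D by apply: open_nbhs_nbhs; split => //; move: Cnu; rewrite -DC.
have [_ [[xi Axi <-] Dxi]] := clp _ _ FvA Dp.
exists xi; split => //.
by apply: CB; rewrite -DC.
Qed.

Lemma continuous_measurable W : continuous W -> measurable_fun setT W.
Proof.
move=> /continuousP cW; apply: (measurability _ (RGenOpens.measurableE R)).
move=> _ [_ [a [b ->] <-]]; rewrite setTI; apply: sub_sigma_algebra.
exact/cW/interval_open.
Qed.

Lemma continuous_bounded W : continuous W -> exists M, forall nu, `|W nu| <= M.
Proof.
move=> cW; have : compact (W @` setT).
  by apply: continuous_compact; [exact: continuous_subspaceT | exact: Delta_compact].
move=> /(@compact_bounded _ R^o)[M [_ HM]]; exists (M + 1) => nu.
by apply: (HM (M + 1)); [rewrite ltrDl | exists nu].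
Qed.

Lemma continuous_integrable P W : continuous W -> P.-integrable setT (EFin \o W).
Proof.
move=> cW; apply: measurable_bounded_integrable => //.
- by rewrite (_ : _ setT = 1%E) ?ltry //; exact: probability_setT.
- exact: continuous_measurable.
- have [M WM] := continuous_bounded cW.
  exists M; split; first exact: num_real.
  by move=> M' MM' nu _ /=; apply: le_trans (WM nu) (ltW MM').
Qed.

Lemma expect_cst P (c : R) : expect P (fun=> c) = c.
Proof. 
rewrite /expect Rintegral_cst // (_ : _ setT = 1%E) ?mulr1 //.
exact: probability_setT.
 Qed.

Lemma expect_le P W W' : continuous W -> continuous W' ->
  (forall nu, W nu <= W' nu) -> expect P W <= expect P W'.
Proof.
by move=> cW cW' WW'; apply: le_Rintegral => // ; exact: continuous_integrable.
Qed.

Lemma expectD P W W' : continuous W -> continuous W' ->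
  expect P (fun nu => W nu + W' nu) = expect P W + expect P W'.
Proof.
by move=> cW cW'; apply: RintegralD => //; exact: continuous_integrable.
Qed.

Lemma expectZ P (a : R) W : continuous W ->
  expect P (fun nu => a * W nu) = a * expect P W.
Proof. by move=> cW; apply: RintegralZl => //; exact: continuous_integrable. Qed.

Lemma expect_dotv P d (g : Delta R hX -> 'rV[R]_d) (l : 'rV[R]_d) :
  continuous g ->
  expect P (fun nu => dotv l (g nu)) = dotv l (\row_i expect P (fun nu => g nu ord0 i)).
Proof.
move=> cg; rewrite /dotv.
under [RHS]eq_bigr do rewrite mxE.
have cgi i : continuous (fun nu => g nu ord0 i).
  move=> nu; apply: (@continuous_comp _ _ _ g (fun M : 'rV[R]_d => M ord0 i)).
    exact: cg.
  exact: coord_continuous.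
have cl i : continuous (fun nu => l ord0 i * g nu ord0 i).
  move=> nu; apply: (@continuousM R (Delta R hX) (cst (l ord0 i)) (fun nu => g nu ord0 i)).
    exact: cst_continuous.
  exact: cgi.
elim: (index_enum _) => [|i s IH].
  by rewrite big_nil; under eq_fun do rewrite big_nil; rewrite expect_cst.
rewrite big_cons -IH -expectZ // -expectD //.
  by congr expect; apply/funext => nu; rewrite big_cons.
exact: (@continuous_sumr R (Delta R hX) R^o).
Qed.

End expectation.

(** * Finitely supported measures and moment vectors *)

Section finite_support.
Context (disp : measure_display) (T : measurableType disp) (R : realType).
Variables (N : nat) (w : 'I_N.+1 -> R) (a : 'I_N.+1 -> T).
Hypothesis hw : simplex R 'I_N.+1 w.

(** Sums of measures are indexed by natural numbers; inord turns an index below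
    N + 1 back into an ordinal. *)
Definition weighted_atom (k : nat) : {measure set T -> \bar R} :=
  mscale (NngNum (hw.1 (inord k))) (dirac (a (inord k))).

Definition weighted_atoms : set T -> \bar R := msum weighted_atom N.+1.

HB.instance Definition _ := Measure.on weighted_atoms.

Lemma weighted_atoms_setT : weighted_atoms setT = 1%E.
Proof.
rewrite /weighted_atoms /msum /= -[in RHS]hw.2 -sumEFin.
apply: eq_bigr => k _.
by rewrite /weighted_atom /mscale /= inord_val diracT mule1.
Qed.

HB.instance Definition _ :=
  Measure_isProbability.Build _ _ _ weighted_atoms weighted_atoms_setT.

Lemma ge0_integral_weighted_atoms (W : T -> R) :
  measurable_fun setT W -> (forall x, 0 <= W x) ->
  \int[weighted_atoms]_x W x = \sum_k w k * W (a k).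
Proof.
move=> mW W0; rewrite /Rintegral /weighted_atoms ge0_integral_measure_sum //.
- transitivity (fine (\sum_(k < N.+1) (w k * W (a k))%:E)%E); last by rewrite sumEFin.
  congr fine; apply: eq_bigr => k _.
  rewrite ge0_integral_mscale //.
  + rewrite integral_dirac //; last by exact/measurable_EFinP.
    by rewrite /= inord_val diracT mul1e.
  + exact/measurable_EFinP.
  + by move=> x _; rewrite lee_fin.
- by move=> x _; rewrite lee_fin.
- exact/measurable_EFinP.
Qed.

End finite_support.

Section moments.
Variables (R : realType) (X : finType) (hX : (0 < #|X|)%N).

(** The formula for nonnegative functions is applied to W + M with M a bound
    of |W|. *)
Lemma expect_weighted_atoms N (w : 'I_N.+1 -> R) (a : 'I_N.+1 -> Delta R hX)
    (hw : simplex R 'I_N.+1 w) (W : Delta R hX -> R) : continuous W ->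
  expect (weighted_atoms a hw : Delta2 R hX) W = \sum_k w k * W (a k).
Proof.
move=> cW; have [M WM] := continuous_bounded cW.
have cWM : continuous (fun nu => W nu + M).
  move=> nu; apply: (@continuousD R R^o (Delta R hX) W (cst M)); first exact: cW.
  exact: cst_continuous.
have /(_ _)/esym := @ge0_integral_weighted_atoms _ _ _ _ w a hw _ (continuous_measurable cWM).
rewrite -[X in _ = X]/(expect (weighted_atoms a hw : Delta2 R hX) _).
rewrite expectD //; last exact: cst_continuous.
rewrite expect_cst.
under eq_bigr do rewrite mulrDr.
rewrite big_split /= -mulr_suml hw.2 mul1r => H.
apply/(@addIr _ M)/esym/H => nu.
by rewrite -lerBlDr sub0r; apply: lerNnormlW.
Qed.

(** A separating functional l would satisfy l(g nu) <= l(g c) < l(E_P[g]) for all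
    nu, where c maximizes l o g; integrating the first inequality contradicts the
    second. *)
Lemma moments_in_hull d (g : Delta R hX -> 'rV[R]_d) (P : Delta2 R hX) :
  continuous g ->
  convex_combs d.+1 (range g) (\row_i expect P (fun nu => g nu ord0 i)).
Proof.
move=> cg; apply: contrapT => nhull.
have cptg : compact (range g).
  by apply: continuous_compact; [exact: continuous_subspaceT | exact: Delta_compact].
have hull_g nu : convex_combs d.+1 (range g) (g nu).
  by apply: sub_convex_combs; exists nu.
have [|l _ lP] := strict_separation (convex_combs_compact cptg)
    (@convex_combs_convex _ _ (range g)) _ nhull.
  by exists (g point).
have clg : continuous (fun nu => dotv l (g nu)).
  by apply: dotv_continuous => // nu; exact: cst_continuous.
have [||c _ cmax] := @compact_EVT_max _ R (fun nu => dotv l (g nu)) _ _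
    (@Delta_compact R X hX).
- by exists point.
- exact: continuous_subspaceT.
have := lP _ (hull_g c); rewrite -expect_dotv // ltNge; apply/negP/negPn.
rewrite -[leRHS](expect_cst P); apply: expect_le => //; first exact: cst_continuous.
by move=> nu; apply: cmax; rewrite inE.
Qed.

End moments.

Section attainable_moments.
Variables (R : realType) (X : finType) (hX : (0 < #|X|)%N) (k : nat).
Variables (V : 'I_k -> Delta R hX -> R) (mu : Delta R hX).
Hypothesis hV : forall i, continuous (V i).

Definition mass_row (nu : Delta R hX) : 'rV[R]_#|X| := \row_i mass nu (enum_val i).

Definition graph_row (nu : Delta R hX) : 'rV[R]_(#|X| + k) :=
  row_mx (mass_row nu) (\row_i V i nu).

(** The first #|X| coordinates of the moments of graph_row form the barycenter,
    so fixing the barycenter is taking a slice. Defined through the hull, the set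
    is visibly compact and convex; attainableP identifies it with the set of
    moment vectors of measures. *)
Definition attainable : set 'rV[R]_k :=
  slice (convex_combs (#|X| + k).+1 (range graph_row)) (mass_row mu).

Lemma graph_rowl nu i : graph_row nu ord0 (lshift k i) = mass nu (enum_val i).
Proof. by rewrite row_mxEl mxE. Qed.

Lemma graph_rowr nu i : graph_row nu ord0 (rshift #|X| i) = V i nu.
Proof. by rewrite row_mxEr mxE. Qed.

Lemma graph_row_continuous : continuous graph_row.
Proof.
apply: continuous_row => i; rewrite -(splitK i); case: fintype.split => j /=.
  by under eq_fun do rewrite graph_rowl; exact: mass_continuous.
by under eq_fun do rewrite graph_rowr; exact: hV.
Qed.

Lemma attainableP v : attainable v <->
  exists2 P : Delta2 R hX, barycenter P = mass mu & v = \row_i expect P (V i).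
Proof.
split=> [[w [s [hw Ss hull_v]]]|[P bary ->]].
  have /choice[a aP] : forall j, exists nu, graph_row nu = s j.
    by move=> j; have [nu _ <-] := Ss j; exists nu.
  have vE i : row_mx (mass_row mu) v ord0 i = \sum_j w j * graph_row (a j) ord0 i.
    by rewrite hull_v summxE; apply: eq_bigr => j _; rewrite mxE aP.
  exists (weighted_atoms a hw : Delta2 R hX).
    apply/funext => x; rewrite /barycenter expect_weighted_atoms; last exact: mass_continuous.
    have := vE (lshift k (enum_rank x)); rewrite row_mxEl mxE enum_rankK => ->.
    by apply: eq_bigr => j _; rewrite graph_rowl enum_rankK.
  apply/rowP => i; rewrite mxE expect_weighted_atoms //.
  have := vE (rshift #|X| i); rewrite row_mxEr => ->.
  by apply: eq_bigr => j _; rewrite graph_rowr.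
have := moments_in_hull P graph_row_continuous.
rewrite /attainable /slice /=; congr convex_combs.
apply/rowP => i; rewrite mxE -(splitK i); case: fintype.split => j /=.
  rewrite row_mxEl mxE -bary; congr expect; apply/funext => nu.
  exact: graph_rowl.
by rewrite row_mxEr mxE; congr expect; apply/funext => nu; exact: graph_rowr.
Qed.

Lemma attainable_compact : compact attainable.
Proof.
apply/slice_compact/convex_combs_compact/continuous_compact.
  by apply: continuous_subspaceT; exact: graph_row_continuous.
exact: Delta_compact.
Qed.

Lemma attainable_convex : @convex_set R 'rV[R]_k attainable.
Proof. exact/slice_convex/convex_combs_convex. Qed.

End attainable_moments.

(** * The constrained maximum *)

(** Among the maximizers of f, the one with the largest coordinate n (the first
    of the last m) is a boundary point of K: raising this coordinate changes
    neither f nor feasibility. *)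
Lemma constrained_max_supported (R : realType) (n m : nat)
    (K : set 'rV[R]_(n + m)) (f : 'rV[R]_(n + m) -> R) :
    (0 < m)%N -> compact K -> @convex_set R 'rV[R]_(n + m) K -> continuous f ->
    (forall x y : 'rV[R]_(n + m),
      (forall i : 'I_(n + m), (i < n)%N -> x ord0 i = y ord0 i) -> f x = f y) ->
  let feasible := [set v | K v /\
    forall i : 'I_(n + m), (n <= i)%N -> 0 <= v ord0 i] in
  feasible !=set0 ->
  exists v l, [/\ feasible v, forall u, feasible u -> f u <= f v,
    dotv l l = 1 & forall u, K u -> dotv l u <= dotv l v].
Proof.
move=> m0 cptK cvxK cf f_last feasible feas0.
have coord_closed i (D : set R) : closed D -> closed [set v : 'rV[R]_(n + m) | D (v ord0 i)].
  have /continuous_closedP := @coord_continuous R 1 (n + m) ord0 i.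
  by apply.
have cpt_feas : compact feasible.
  have -> : feasible = K `&` \bigcap_(i in [set i : 'I_(n + m) | (n <= i)%N])
      [set v : 'rV[R]_(n + m) | 0 <= v ord0 i].
    by apply/seteqP; split.
  apply: compact_closedI cptK _; apply: closed_bigI => i _.
  exact: (coord_closed i [set y | 0 <= y] (@closed_ge _ 0)).
have [|w /set_mem feas_w wmax] := @compact_EVT_max _ R f feasible feas0 cpt_feas.
  exact: continuous_subspaceT.
pose M := feasible `&` [set v | f v = f w].
have cptM : compact M.
  apply: compact_closedI cpt_feas _.
  have /continuous_closedP/(_ [set f w]) := cf.
  by apply; exact: closed_eq.
pose j : 'I_(n + m) := rshift n (Ordinal m0).
have [||v /set_mem [feas_v fv] vmax] :=
    @compact_EVT_max _ R (fun v : 'rV[R]_(n + m) => v ord0 j) M _ cptM.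
- by exists w.
- by apply: continuous_subspaceT; exact: coord_continuous.
have Kv eps : 0 < eps -> ~ K (v + eps *: delta_mx ord0 j).
  move=> eps0 Kv.
  have vE i : (v + eps *: delta_mx ord0 j) ord0 i = v ord0 i + eps * (i == j)%:R.
    by rewrite !mxE eqxx.
  have : M (v + eps *: delta_mx ord0 j).
    split; first split => // i ni.
      by rewrite vE addr_ge0 ?mulr_ge0 ?ler0n ?(ltW eps0) //; exact: feas_v.2.
    rewrite /= -fv; apply: f_last => i ni.
    rewrite vE (_ : (i == j) = false) ?mulr0 ?addr0 //.
    by apply/negbTE; apply: contraTN ni => /eqP ->; rewrite /= -leqNgt leq_addr.
  move=> /mem_set/vmax; rewrite vE eqxx mulr1.
  by rewrite leNgt ltrDl eps0.
have [l l1 lP] := supporting_functional cptK cvxK feas_v.1 Kv.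
exists v, l; split => // u /mem_set feas_u.
by rewrite fv; exact: wmax.
Qed.

Theorem theorem3 (R : realType) (n m : nat) (hn : (1 <= n)%N) (hm : (1 <= m)%N)
  (X : finType) (hX : (0 < #|X|)%N)
  (V : 'I_(n + m) -> Delta R hX -> R) (hV : forall i, continuous (V i))
  (f : 'rV[R]_(n + m) -> R) (hf : continuous f)
  (hf_last : forall x y : 'rV[R]_(n + m),
    (forall i : 'I_(n + m), (i < n)%N -> x ord0 i = y ord0 i) -> f x = f y)
  (mu : Delta R hX)
  (hfeas : exists P : Delta2 R hX, barycenter P = mass mu /\
    forall i : 'I_(n + m), (n <= i)%N -> 0 <= expect P (V i)) :
  exists (Pstar : Delta2 R hX) (lambda : 'rV[R]_(n + m)),
    [/\ solves_sup (fun P : Delta2 R hX => f (\row_i expect P (V i)))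
          [set P | (forall i : 'I_(n + m), (n <= i)%N -> 0 <= expect P (V i))
                   /\ barycenter P = mass mu]
          Pstar,
        lambda != 0,
        eucl_norm lambda <= 1 &
        argmax
          (fun P : Delta2 R hX =>
             expect P (fun nu => \sum_(i < n + m) lambda ord0 i * V i nu))
          [set P | barycenter P = mass mu]
          Pstar].
Proof.
have att P : barycenter P = mass mu -> attainable V mu (\row_i expect P (V i)).
  by move=> bary; apply/(attainableP _ hV); exists P.
have linE (l : 'rV[R]_(n + m)) (P : Delta2 R hX) :
    expect P (fun nu => \sum_(i < n + m) l ord0 i * V i nu) =
    dotv l (\row_i expect P (V i)).
  have cV : continuous (fun nu => \row_i V i nu : 'rV[R]_(n + m)).
    by apply: continuous_row => i; under eq_fun do rewrite mxE; exact: hV.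
  have := expect_dotv P l cV.
  under eq_fun do rewrite /dotv; under eq_fun do under eq_bigr do rewrite mxE.
  move=> ->; congr dotv; apply/rowP => i; rewrite !mxE.
  by congr expect; apply/funext => nu; rewrite mxE.
have [|v [l [[Kv v0] vmax l1 lP]]] := constrained_max_supported hm
    (attainable_compact hV) (attainable_convex (V := V) (mu := mu)) hf hf_last.
  have [P [bary P0]] := hfeas.
  by exists (\row_i expect P (V i)); split => [|i ni]; [exact: att | rewrite mxE P0].
have [Pstar bary vE] := (attainableP mu hV v).1 Kv.
exists Pstar, l; split.
- split; first by split => // i ni; have := v0 i ni; rewrite vE mxE.
  apply/eqP; rewrite eq_le; apply/andP; split.
    apply: ereal_sup_ubound; exists Pstar => //.
    by split => // i ni; have := v0 i ni; rewrite vE mxE.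
  apply: ub_ereal_sup => _ [P [P0 baryP] <-]; rewrite lee_fin -vE; apply: vmax.
  by split => [|i ni]; [exact: att | rewrite mxE P0].
- by rewrite -dotvv_gt0 l1 ltr01.
- rewrite /eucl_norm (eq_bigr (fun i => l ord0 i * l ord0 i)) => [|i _]; last by rewrite expr2.
  by rewrite -[X in Num.sqrt X]/(dotv l l) l1 sqrtr1.
- split => // P baryP; rewrite !linE -vE; apply: lP; exact: att.
Qed.
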